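(* For every positive integer $n$, the number of quasi-Stirling permutations $\pi$ of size $n$ with $\operatorname{des}(\pi)=n$ is equal to $(n+1)^{n-1}$.
   Context: A quasi-Stirling permutation of size $n$ is a sequence $\pi=\pi_1\pi_2\cdots\pi_{2n}$ that is a permutation of the multiset $\{1,1,2,2,\dots,n,n\}$ and avoids the patterns $1212$ and $2121$, i.e. there are no indices $i<j<k<\ell$ with $\pi_i=\pi_k$ and $\pi_j=\pi_\ell$. For a sequence $\pi=\pi_1\cdots\pi_r$ of positive integers, an index $i\in\{1,\dots,r\}$ is a descent if $\pi_i>\pi_{i+1}$ or $i=r$ (so the last position always counts as a descent), and $\operatorname{des}(\pi)$ is the number of descents. *)

(* Defs.v *)
From mathcomp Require Import all_boot.
Set Implicit Arguments. Unset Strict Implicit. Unset Printing Implicit Defensive.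

Definition stirling_multiset (n : nat) : seq nat :=
  flatten [seq [:: i; i] | i <- iota 1 n].

(* s contains no occurrence of 1212 or 2121: no indices i<j<k<l with
   s_i = s_k, s_j = s_l and s_i <> s_j (equal letters would not be an
   occurrence of a pattern with two distinct values). *)
Definition avoids_1212_2121 (s : seq nat) : bool :=
  [forall i : 'I_(size s), forall j : 'I_(size s), forall k : 'I_(size s),
   forall l : 'I_(size s),
    [&& i < j, j < k, k < l, nth 0 s i == nth 0 s k & nth 0 s j == nth 0 s l]
    ==> (nth 0 s i == nth 0 s j)].

Definition quasi_stirling (n : nat) (s : seq nat) : bool :=
  perm_eq s (stirling_multiset n) && avoids_1212_2121 s.

Definition des (s : seq nat) : nat :=
  #|[set i : 'I_(size s) | (i.+1 == size s) || (nth 0 s i.+1 < nth 0 s i)]|.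

Definition qs_des_n (n : nat) : {set (n.*2).-tuple 'I_n.+1} :=
  [set t : (n.*2).-tuple 'I_n.+1 | quasi_stirling n (map val t) && (des (map val t) == n)].

(* Main.v *)
Require Import Defs.
From HB Require Import structures.
From mathcomp Require Import all_boot zify.
Set Implicit Arguments. Unset Strict Implicit. Unset Printing Implicit Defensive.

(* A quasi-Stirling permutation is the contour word of an ordered forest with
   distinct node labels, each label being written on entering and on leaving
   its node. Adding a root 0, the descents of the word are the cyclic descents
   of the sequences (p, c1, ..., ck), where c1, ..., ck are the children of p.
   Such a sequence has at least one cyclic non-descent, hence at most k cyclic
   descents, so that n descents in total forces every (p, c1, ..., ck) to be a
   rotation of a decreasing sequence: the order of the children is determined
   by their set. What remains is to count labelled rooted trees. If T(u, k) is
   the number of ways to hang u labels below k given roots, then choosing the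
   set of children of the first root gives the recurrence
   T(u, k) = sum_j 'C(u, j) T(u - j, k - 1 + j), whence
   (u + k) T(u, k) = k (u + k) ^ u, and the case u = n, k = 1 is the claim. *)

(** * Cyclic non-descents and rotations of decreasing sequences *)

(* Non-descents of the word [x :: s]: equal neighbours count. *)
Fixpoint ascs (x : nat) (s : seq nat) : nat :=
  if s is y :: s' then (x <= y) + ascs y s' else 0.

Lemma ascs_cat x s t : ascs x (s ++ t) = ascs x s + ascs (last x s) t.
Proof. by elim: s x => //= y s IHs x; rewrite IHs addnA. Qed.

Lemma ascs_eq0 x s : (ascs x s == 0) = path gtn x s.
Proof.
by elim: s x => //= y s IHs x; rewrite addn_eq0 IHs eqb0 -ltnNge.
Qed.

Lemma gtn_trans : transitive gtn.
Proof. by move=> y x z /= lyx lzy; apply: ltn_trans lzy lyx. Qed.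

Lemma geq_trans : transitive geq.
Proof. by move=> y x z /= lyx lzy; apply: leq_trans lzy lyx. Qed.

Lemma geq_antisym : antisymmetric geq.
Proof. by move=> x y /= /andP[lyx lxy]; apply/eqP; rewrite eqn_leq lyx lxy. Qed.

Lemma sorted_gtn_geq s : sorted gtn s -> sorted geq s.
Proof. by apply: sub_sorted => x y /=; apply: ltnW. Qed.

Lemma sorted_geq_gtn s : uniq s -> sorted geq s -> sorted gtn s.
Proof.
elim: s => //= x s IHs /andP[xNs Us]; rewrite (path_sortedE geq_trans).
case/andP=> ge_x ss; rewrite (path_sortedE gtn_trans) IHs // andbT.
apply/allP=> y ys /=; have /= le_yx := allP ge_x y ys.
rewrite ltn_neqAle le_yx andbT.
by apply: contraNneq xNs => <-.
Qed.

Lemma ascs_cyclic_gt0 p l : 0 < ascs p (rcons l p).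
Proof.
rewrite lt0n ascs_eq0; apply/negP=> /(order_path_min gtn_trans).
by rewrite all_rcons /= ltnn.
Qed.

(* The only rotation of a decreasing sequence of [p :: J] that starts at [p]. *)
Definition cyc_sort (p : nat) (J : seq nat) : seq nat :=
  [seq x <- sort geq J | x < p] ++ [seq x <- sort geq J | p <= x].

Lemma perm_cyc_sort p J : perm_eq (cyc_sort p J) J.
Proof.
apply: (@perm_trans _ (sort geq J)); last by rewrite perm_sort.
have eqC : (fun x => p <= x) =1 predC (fun x => x < p).
  by move=> x /=; rewrite leqNgt.
by rewrite /cyc_sort (eq_filter eqC); apply/permPl/perm_filterC.
Qed.

(** A decreasing sequence is determined by its letters, and the bounds on [s1] and [s2] say which
    letters of [J] each one holds. *)
Lemma cyc_sort_cat p J s1 s2 : sorted gtn s1 -> sorted gtn s2 ->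
  all (fun x => x < p) s1 -> all (fun x => p <= x) s2 ->
  perm_eq J (s1 ++ s2) -> cyc_sort p J = s1 ++ s2.
Proof.
move=> ss1 ss2 lt1 ge2 permJ.
have geq_total : total geq by move=> x y; apply: leq_total.
have sJ := sort_sorted geq_total J.
have pJ : perm_eq (sort geq J) (s1 ++ s2) by rewrite perm_sort.
congr (_ ++ _); apply: (sorted_eq geq_trans geq_antisym);
  do ?[exact: (sorted_filter geq_trans) | exact: sorted_gtn_geq].
  apply: (perm_trans (perm_filter _ pJ)); rewrite filter_cat (all_filterP lt1).
  rewrite (eq_in_filter (a2 := pred0)) ?filter_pred0 ?cats0 // => x x2.
  by rewrite ltnNge (allP ge2).
apply: (perm_trans (perm_filter _ pJ)); rewrite filter_cat (all_filterP ge2).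
rewrite (eq_in_filter (a2 := pred0)) ?filter_pred0 // => x x1.
by rewrite leqNgt (allP lt1).
Qed.

Lemma ascs_eq1 x s : ascs x s = 1 ->
  exists s1 y s2, [/\ s = s1 ++ y :: s2, path gtn x s1, last x s1 <= y
                    & path gtn y s2].
Proof.
elim: s x => //= y s IHs x; case: leqP => [lexy | ltyx] /=.
  by case=> /eqP; rewrite ascs_eq0 => ys; exists [::], y, s.
rewrite add0n => /IHs[s1 [z [s2 [-> ys1 lez zs2]]]].
by exists (y :: s1), z, s2; rewrite /= ltyx.
Qed.

(** The single non-descent cuts the cycle into a run descending from [p] and a run descending to
    [p], hence into the letters below [p] and those above it. *)
Lemma cyc_sort_unique p J l : perm_eq J l -> ascs p (rcons l p) = 1 -> cyc_sort p J = l.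
Proof.
move=> permJ /ascs_eq1[s1 [y [s2 []]]].
(* With [s2] empty, the non-descent is the step into the closing [p], so all of [l] lies below [p];
   otherwise the closing [p] ends the second run. *)
case/lastP: s2 => [|s2 z].
  rewrite cats1 => /rcons_inj[eql eqy] ps1 _ _; subst l y.
  rewrite (cyc_sort_cat (s1 := s1) (s2 := [::])) ?cats0 ?(path_sorted ps1) //.
  exact: order_path_min gtn_trans ps1.
rewrite -rcons_cons -rcons_cat => /rcons_inj[eql eqz] ps1 _ ys2; subst l z.
apply: cyc_sort_cat => //; first exact: path_sorted ps1.
- by move: ys2; rewrite rcons_path => /andP[].
- exact: order_path_min gtn_trans ps1.
apply/allP=> x x_s; have : pairwise gtn (rcons (y :: s2) p).
  by rewrite -(sorted_pairwise gtn_trans).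
by rewrite pairwise_rcons => /andP[/allP/(_ x x_s) /ltnW].
Qed.

(** Only the junction of the two blocks is a non-descent, or the return to [p] if the second block
    is empty. *)
Lemma ascs_cyc_sort p J : uniq (p :: J) -> ascs p (rcons (cyc_sort p J) p) = 1.
Proof.
rewrite /cyc_sort -(perm_uniq (s1 := p :: sort geq J)) ?perm_cons ?perm_sort //.
have geq_total : total geq by move=> x y; apply: leq_total.
have := sort_sorted geq_total J; move: (sort geq J) => s ss /= /andP[pNs Us].
have {}ss := sorted_geq_gtn Us ss.
have ps1 : path gtn p [seq x <- s | x < p].
  by rewrite (path_sortedE gtn_trans) filter_all (sorted_filter gtn_trans).
have le1 : last p [seq x <- s | x < p] <= p.
  case/lastP: [seq x <- s | x < p] (filter_all (fun x => x < p) s) => //= t x.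
  by rewrite all_rcons last_rcons => /andP[/ltnW].
rewrite rcons_cat ascs_cat; move: ps1; rewrite -ascs_eq0 => /eqP ->; rewrite add0n.
have : sorted gtn (rcons [seq x <- s | p <= x] p).
  rewrite (sorted_pairwise gtn_trans) pairwise_rcons -(sorted_pairwise gtn_trans).
  rewrite (sorted_filter gtn_trans) // andbT; apply/allP=> x.
  rewrite mem_filter => /andP[lepx xs] /=; rewrite ltn_neqAle lepx andbT.
  by apply: contraNneq pNs => ->.
case: [seq x <- s | p <= x] (filter_all (fun x => p <= x) s) => [_ _|y t] /=.
  by rewrite le1.
by case/andP=> lepy _; rewrite -ascs_eq0 => /eqP->; rewrite (leq_trans le1).
Qed.

(** * Ordered forests and their contour words *)

(* [Fcons a f g] is the ordered forest whose first tree has root [a] and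
   subforest [f], and whose remaining trees form [g]. *)
Inductive forest := Fnil | Fcons of nat & forest & forest.

Lemma forest_comparable : comparable forest.
Proof. by move=> f g; rewrite /decidable; decide equality; apply: eq_comparable. Qed.

HB.instance Definition _ := hasDecEq.Build forest (compareP forest_comparable).

Fixpoint word f := if f is Fcons a f g then a :: word f ++ a :: word g else [::].
Fixpoint labels f := if f is Fcons a f g then a :: labels f ++ labels g else [::].
Fixpoint tops f := if f is Fcons a _ g then a :: tops g else [::].
Fixpoint subs f := if f is Fcons _ f g then f :: subs g else [::].

Fixpoint assemble (l : seq nat) (fs : seq forest) : forest :=
  match l, fs with
  | c :: l', g :: fs' => Fcons c g (assemble l' fs')
  | _, _ => Fnil
  end.

Lemma size_subs f : size (subs f) = size (tops f).
Proof. by elim: f => //= a f _ g ->. Qed.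

Lemma assemble_tops_subs f : assemble (tops f) (subs f) = f.
Proof. by elim: f => //= a f _ g ->. Qed.

Lemma tops_assemble l fs : size l = size fs -> tops (assemble l fs) = l.
Proof. by elim: l fs => [|c l IHl] [|g fs] //= [/IHl->]. Qed.

Lemma subs_assemble l fs : size l = size fs -> subs (assemble l fs) = fs.
Proof. by elim: l fs => [|c l IHl] [|g fs] //= [/IHl->]. Qed.

Lemma perm_labels f : perm_eq (labels f) (tops f ++ flatten (map labels (subs f))).
Proof.
elim: f => //= a f _ g IHg; rewrite perm_cons perm_sym perm_catCA perm_cat2l.
by rewrite perm_sym.
Qed.

Lemma perm_word f : perm_eq (word f) (labels f ++ labels f).
Proof.
elim: f => //= a f IHf g IHg; rewrite perm_cons; apply/permP=> P.
move/permP/(_ P): IHf; move/permP/(_ P): IHg.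
rewrite !count_cat /= !count_cat; lia.
Qed.

Lemma mem_word f : word f =i labels f.
Proof. by move=> x; rewrite (perm_mem (perm_word f)) mem_cat orbb. Qed.

(** * Counting non-descents node by node *)

Fixpoint inner_good f :=
  if f is Fcons a f g then
    [&& ascs a (rcons (tops f) a) == 1, inner_good f & inner_good g]
  else true.

Definition good p f := (ascs p (rcons (tops f) p) == 1) && inner_good f.

Lemma inner_goodE f : inner_good f = all2 good (tops f) (subs f).
Proof. by elim: f => //= a f _ g ->; rewrite /good andbA. Qed.

Fixpoint inner_ascs f :=
  if f is Fcons a f g then
    ascs a (rcons (tops f) a) + inner_ascs f + inner_ascs g
  else 0.

(** The block of a tree starts and ends with its root [a], so from outside it behaves like the
    single letter [a]; inside, it is a word read from [a] back to [a]. *)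
Lemma ascs_word x f q :
  ascs x (rcons (word f) q) = ascs x (rcons (tops f) q) + inner_ascs f.
Proof.
elim: f x q => [|a f IHf g IHg] x q /=; first by rewrite !addn0.
rewrite rcons_cat rcons_cons -cat_rcons ascs_cat IHf last_rcons IHg; lia.
Qed.

(** Every node contributes at least one non-descent, so equality holds exactly when each contributes
    one. *)
Lemma inner_ascs_ge f : size (labels f) <= inner_ascs f ?= iff inner_good f.
Proof.
elim: f => [|a f IHf g IHg] /=; first by split.
have leif1 : 1 <= ascs a (rcons (tops f) a) ?= iff (ascs a (rcons (tops f) a) == 1).
  by split; [apply: ascs_cyclic_gt0 | rewrite eq_sym].
by have := leqif_add (leqif_add leif1 IHf) IHg; rewrite size_cat -andbA -addnA add1n.
Qed.

Lemma ascs_good p f : (ascs p (rcons (word f) p) == (size (labels f)).+1) = good p f.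
Proof.
rewrite ascs_word /good.
have leif1 : 1 <= ascs p (rcons (tops f) p) ?= iff (ascs p (rcons (tops f) p) == 1).
  by split; [apply: ascs_cyclic_gt0 | rewrite eq_sym].
by have [_ <-] := leqif_add leif1 (inner_ascs_ge f); rewrite eq_sym add1n.
Qed.

(** * Contour words as noncrossing words *)

Lemma cat_cons_inj (T : eqType) (a : T) x y x' y' : a \notin x -> a \notin x' ->
  x ++ a :: y = x' ++ a :: y' -> x = x' /\ y = y'.
Proof.
elim: x x' => [|b x IHx] [|c x'] //=.
- by move=> _ _ [->].
- by move=> _ aN [eqac]; rewrite inE eqac eqxx in aN.
- by move=> aN _ [eqac]; rewrite inE eqac eqxx in aN.
rewrite !inE !negb_or => /andP[_ ax] /andP[_ ax'] [-> /IHx].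
by case=> // -> ->.
Qed.

(** Without repeated labels, the second occurrence of the first letter marks the end of the first
    tree. *)
Lemma word_inj f g : uniq (labels f) -> uniq (labels g) -> word f = word g -> f = g.
Proof.
elim: f g => [|a f1 IH1 f2 IH2] [|b g1 g2] //=.
rewrite !mem_cat !negb_or !cat_uniq => /andP[/andP[a1 _] /and3P[Uf1 _ Uf2]].
case/andP=> /andP[b1 _] /and3P[Ug1 _ Ug2] [eqab]; subst b.
by case/cat_cons_inj; rewrite ?mem_word // => /IH1-> // /IH2->.
Qed.

(** One pattern covers both 1212 and 2121, since [a] and [b] come in no fixed order. *)
Definition noncrossing (s : seq nat) :=
  forall a b, subseq [:: a; b; a; b] s -> a = b.

Lemma subseq_cat_split (T : eqType) (t s1 s2 : seq T) : subseq t (s1 ++ s2) ->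
  exists t1 t2, [/\ t = t1 ++ t2, subseq t1 s1 & subseq t2 s2].
Proof.
elim: s1 t => [|x s1 IHs] t /=; first by exists [::], t.
case: t => [|y t]; first by exists [::], [::]; rewrite !sub0seq.
case: (y =P x) => [-> | neq] /IHs[t1 [t2 [eqt sub1 sub2]]].
  by exists (x :: t1), t2; rewrite eqt /= eqxx.
exists t1, t2; split=> //; case: t1 eqt sub1 => //= z t1 [<- _].
by case: eqP neq.
Qed.

(** A crossing is split at the second [c]. As [f] and [g] share no label and neither contains [c],
    each case yields a forbidden common letter or a crossing inside one part. *)
Lemma noncrossing_word f : uniq (labels f) -> noncrossing (word f).
Proof.
elim: f => [_ a b|c f IHf g IHg] //=.
rewrite mem_cat negb_or cat_uniq -!mem_word => /andP[/andP[cf cg]].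
case/and3P=> /IHf nf fg /IHg ng a b; apply: contraTeq => neq_ab.
have disj x : x \in word f -> x \in word g -> False.
  rewrite !mem_word => xf xg; case/hasP: fg; by exists x.
have sub_mem x t s : subseq (T := nat) t s -> x \in t -> x \in s.
  by move=> sub; apply: mem_subseq sub x.
have [eac|nac] := eqVneq a c.
  subst c; rewrite /= eqxx; apply/negP=> /subseq_cat_split[t1 [t2 [eqt s1 s2]]].
  case: t1 => [|x [|y t1]] in eqt s1 *.
  - rewrite /= in eqt; subst t2; move: s2; rewrite /= eq_sym (negPf neq_ab) => s2.
    by case/negP: cg; apply: sub_mem s2 _; rewrite !inE eqxx orbT.
  - case: eqt => eqb eqt; subst x t2; move: s2 => /=; rewrite eqxx sub1seq.
    by apply: disj; rewrite -sub1seq.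
  case: eqt => _ eqa _; subst y; case/negP: cf.
  by apply: sub_mem s1 _; rewrite !inE eqxx orbT.
rewrite [subseq _ _]/= (negPf nac); apply/negP=> /subseq_cat_split[t1 [t2 [eqt s1 s2]]].
have [ebc|nbc] := eqVneq b c.
  subst c; case: t1 => [|x [|y t1]] in eqt s1 *.
  - rewrite /= in eqt; subst t2; move: s2; rewrite /= (negPf neq_ab) => s2.
    by case/negP: cg; apply: sub_mem s2 _; rewrite !inE eqxx !orbT.
  - case: eqt => _ eqt; subst t2; move: s2 => /=; rewrite eqxx => s2.
    by case/negP: cg; apply: sub_mem s2 _; rewrite !inE eqxx !orbT.
  case: eqt => _ eqa _; subst y; case/negP: cf.
  by apply: sub_mem s1 _; rewrite !inE eqxx orbT.
have {}s2 : subseq t2 (word g).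
  move: s2; case: t2 eqt => [|x t2]; first by move=> *; apply: sub0seq.
  move=> eqt; rewrite /=; case: eqP => // eqx; subst x.
  have : c \in [:: a; b; a; b] by rewrite eqt mem_cat inE eqxx orbT.
  by rewrite !inE eq_sym (negPf nac) eq_sym (negPf nbc).
have memU x : x \in t1 -> x \in t2 -> False.
  by move=> x1 x2; apply: (disj x); [apply: sub_mem s1 x1 | apply: sub_mem s2 x2].
(* If [t1] and [t2] are both nonempty, [a] begins [t1] and [b] ends [t2]; the second [a] then lies
   in [t2], or puts the first [b] into [t1], so a letter is shared. *)
case: t1 => [|x1 t1] in eqt s1 memU *.
  by rewrite /= in eqt; subst t2; move/eqP: neq_ab; apply; apply: ng.
case/lastP: t2 => [|t2 y] in eqt s2 memU *.
  by rewrite cats0 in eqt; rewrite -eqt in s1; move/eqP: neq_ab; apply; apply: nf.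
rewrite -[RHS]rcons_cat in eqt; case/(@rcons_inj _ [:: a; b; a]): eqt => eqa eqt eqb.
subst x1 y.
have : a \in t1 ++ t2 by rewrite -eqt !inE eqxx orbT.
rewrite mem_cat => /orP[a1 | a2]; last first.
  by apply: (memU a); rewrite ?inE ?mem_rcons ?inE ?eqxx ?a2 ?orbT.
case: t1 => [|x t1] // in eqt s1 memU a1 *; case: eqt => eqb _; subst x.
by apply: (memU b); rewrite ?mem_rcons !inE eqxx ?orbT.
Qed.

Lemma noncrossing_sub s t : subseq s t -> noncrossing t -> noncrossing s.
Proof. by move=> st nct a b sub; apply: nct; apply: subseq_trans st. Qed.

(** The word is cut at the second occurrence of its first letter [a]. A letter on both sides of the
    cut would cross [a], so each side contains its letters twice and induction applies. *)
Lemma noncrossing_forest s : noncrossing s ->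
  {in s, forall x, count_mem x s = 2} -> exists f, s = word f.
Proof.
have [m] := ubnP (size s); elim: m s => // m IHm [|a s] /= lesm ncs c2.
  by exists Fnil.
have ca : count_mem a s = 1.
  by have := c2 a; rewrite inE eqxx => /(_ isT) [].
have : a \in s by rewrite -has_pred1 has_count ca.
case/splitPr defs: s / => [x y]; subst s.
move: ca; rewrite count_cat /= eqxx addnCA add1n => -[] /eqP.
rewrite addn_eq0 => /andP[/eqP/count_memPn ax /eqP/count_memPn ay].
have disj b : b \in x -> b \in y -> False.
  move=> bx by_; suff eqab : a = b by rewrite eqab bx in ax.
  apply: ncs; rewrite /= eqxx.
  apply: (@cat_subseq _ [:: b] [:: a; b]); rewrite ?sub1seq //=.
  by rewrite eqxx sub1seq.
have size_xy : size x < m /\ size y < m by move: lesm; rewrite size_cat /=; lia.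
have [||f defx] := IHm x size_xy.1.
- apply: noncrossing_sub ncs; apply: subseq_trans (subseq_cons _ _).
  exact: prefix_subseq.
- move=> b bx; have := c2 b; rewrite inE mem_cat bx orbT => /(_ isT).
  rewrite count_cat /=; case: eqP => [eqab | _]; first by rewrite eqab bx in ax.
  have /count_memPn -> : b \notin y by apply/negP; apply: disj bx.
  by rewrite !addn0.
have [||g defy] := IHm y size_xy.2.
- apply: noncrossing_sub ncs; apply: subseq_trans (subseq_cons _ _).
  by apply: subseq_trans (suffix_subseq _ _); apply: subseq_cons.
- move=> b by_; have := c2 b; rewrite inE mem_cat inE by_ !orbT => /(_ isT).
  rewrite count_cat /=; case: eqP => [eqab | _]; first by rewrite eqab by_ in ay.
  have /count_memPn -> : b \notin x by apply/negP=> /disj; apply.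
  by [].
by exists (Fcons a f g); rewrite defx defy.
Qed.

Lemma avoidsP s : reflect (noncrossing s) (avoids_1212_2121 s).
Proof.
apply: (iffP idP) => [av a b | nc].
  have step x t s' : subseq (x :: t) s' ->
      exists2 i, i < size s' & nth 0 s' i = x /\ subseq t (drop i.+1 s').
    elim: s' => //= y s' IHs; case: eqP => [-> | _] sub.
      by exists 0; rewrite // drop0.
    by have [i lti [eqx sub']] := IHs sub; exists i.+1.
  case/step=> i lti [eqi /step[j ltj [eqj /step[k ltk [eqk /step[l ltl [eql _]]]]]]].
  rewrite !drop_drop !nth_drop !size_drop in ltj eqj ltk eqk ltl eql.
  (* [j], [k] and [l] are offsets in successive suffixes; these are the positions in [s]. *)
  pose j' := i.+1 + j; pose k' := j.+1 + i.+1 + k; pose l' := k.+1 + (j.+1 + i.+1) + l.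
  have ltj' : j' < size s by rewrite -ltn_subRL.
  have ltk' : k' < size s by rewrite -ltn_subRL.
  have ltl' : l' < size s by rewrite -ltn_subRL.
  move/forallP/(_ (Ordinal lti))/forallP/(_ (Ordinal ltj')): av.
  move/forallP/(_ (Ordinal ltk'))/forallP/(_ (Ordinal ltl')) => /= /implyP.
  rewrite /j' /k' /l' eqi eqj eqk eql !eqxx /= => H; apply/eqP/H; lia.
apply/forallP=> i; apply/forallP=> j; apply/forallP=> k; apply/forallP=> l.
apply/implyP=> /and5P[lij ljk lkl /eqP eik /eqP ejl]; apply/eqP/nc.
rewrite {2}eik {2}ejl.
have drop_sub x t (m : 'I_(size s)) : x <= m -> subseq t (drop m.+1 s) ->
    subseq (nth 0 s m :: t) (drop x s).
  move=> lexm sub; apply: (@subseq_trans _ (drop m s)).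
    by rewrite (drop_nth 0) ?ltn_ord //= eqxx.
  rewrite -[X in subseq _ X](cat_take_drop (m - x)) drop_drop subnK //.
  exact: suffix_subseq.
rewrite -[X in subseq _ X](drop0 s).
by do 4![apply/drop_sub => //]; apply: sub0seq.
Qed.

(** * Quasi-Stirling permutations and their descents *)

Lemma perm_stirling_multiset n : perm_eq (stirling_multiset n) (iota 1 n ++ iota 1 n).
Proof.
rewrite /stirling_multiset; elim: (iota 1 n) => //= x s IHs.
by rewrite perm_cons perm_sym -cat1s perm_catCA /= perm_cons perm_sym.
Qed.

Lemma quasi_stirlingP n s :
  reflect (exists2 f, s = word f & perm_eq (labels f) (iota 1 n)) (quasi_stirling n s).
Proof.
apply: (iffP andP) => [[perm_s /avoidsP ncs] | [f -> perm_f]].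
  have {}perm_s := perm_trans perm_s (perm_stirling_multiset n).
  have [f defs] : exists f, s = word f.
    apply: noncrossing_forest => // x; rewrite (perm_mem perm_s) mem_cat orbb.
    move=> x_n; rewrite (permP perm_s) count_cat count_uniq_mem ?iota_uniq //.
    by rewrite x_n.
  exists f => //; rewrite defs in perm_s; apply/permP=> P.
  move/permP/(_ P): perm_s; rewrite (permP (perm_word f)) !count_cat; lia.
split; last by apply/avoidsP/noncrossing_word; rewrite (perm_uniq perm_f) iota_uniq.
rewrite perm_sym; apply: (perm_trans (perm_stirling_multiset n)).
rewrite perm_sym; apply: (perm_trans (perm_word f)).
exact: perm_cat.
Qed.

(** Framing [s] by zeros adds an initial non-descent and turns the conventional last descent into a
    true one; the [(size s).+1] adjacent pairs are then descents or non-descents. *)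
Lemma des_ascs s : s != [::] -> 0 \notin s ->
  des s + ascs 0 (rcons s 0) = (size s).+1.
Proof.
move=> s_neq0 s_gt0.
have -> : des s = \sum_(i < size s) (nth 0 s i.+1 < nth 0 s i).
  rewrite /des -sum1dep_card big_mkcond /=; apply: eq_bigr => i _.
  (* Past the last position [nth] returns the default 0, below every letter of [s], so the strict
     comparison covers the end convention. *)
  case: eqP => [-> | _]; last by case: ltnP.
  rewrite nth_default //= lt0n; suff -> : nth 0 s i != 0 by [].
  by apply: contraNneq s_gt0 => <-; rewrite mem_nth.
case: s s_neq0 {s_gt0} => //= x s _; rewrite add1n addnS; congr _.+1.
elim: s x => [|y s IHs] x; first by rewrite big_ord_recl big_ord0 /=; case: ltngtP.
rewrite big_ord_recl /= addnACA IHs.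
by case: ltnP.
Qed.

(** * Splitting a set of labels in two *)

Fixpoint splits (T : Type) (U : seq T) : seq (seq T * seq T) :=
  if U is x :: U' then
    [seq (x :: JK.1, JK.2) | JK <- splits U'] ++
    [seq (JK.1, x :: JK.2) | JK <- splits U']
  else [:: ([::], [::])].

Lemma splits_perm (T : eqType) (U : seq T) JK :
  JK \in splits U -> perm_eq (JK.1 ++ JK.2) U.
Proof.
elim: U JK => [|x U IHU] JK /=; first by rewrite inE => /eqP->.
rewrite mem_cat => /orP[] /mapP[{}JK /IHU permU ->] /=.
  by rewrite perm_cons.
by rewrite -cat1s perm_catCA /= perm_cons.
Qed.

Lemma mem_splits (T : eqType) (P : pred T) (U : seq T) :
  (filter P U, filter (predC P) U) \in splits U.
Proof.
elim: U => //= x U IHU; rewrite mem_cat.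
by case: (P x) => /=; apply/orP; [left | right]; apply: map_f IHU.
Qed.

Lemma splits_inj (T : eqType) (U : seq T) : uniq U ->
  {in splits U &, forall JK JK', JK.1 =i JK'.1 -> JK = JK'}.
Proof.
elim: U => [_|x U IHU /= /andP[xNU UU]].
  by move=> JK JK' /=; rewrite !inE => /eqP-> /eqP->.
have xN JK : JK \in splits U -> x \notin JK.1.
  by move/splits_perm/perm_mem/(_ x); rewrite mem_cat (negPf xNU) => /negbT/norP[].
move=> JK0 JK0'; rewrite !mem_cat.
move=> /orP[] /mapP[JK JKU ->] /orP[] /mapP[JK' JKU' ->] /= eqJ.
- rewrite (IHU UU JK JK') // => y; have := eqJ y; rewrite !inE.
  by case: eqP => //= -> _; rewrite !(negPf (xN _ _)).
- by have := eqJ x; rewrite mem_head (negPf (xN _ JKU')).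
- by have := eqJ x; rewrite mem_head (negPf (xN _ JKU)).
by rewrite (IHU UU JK JK').
Qed.

Lemma splits_uniq (T : eqType) (U : seq T) : uniq U -> uniq (splits U).
Proof.
elim: U => //= x U IHU /andP[xNU UU]; rewrite cat_uniq !map_inj_uniq ?IHU //=.
- rewrite andbT; apply/hasPn=> _ /mapP[JK JKU ->]; apply/mapP=> -[JK' _ [eqJ _]].
  have := perm_mem (splits_perm JKU) x.
  by rewrite mem_cat eqJ mem_head (negPf xNU).
- by move=> [J K] [J' K'] /= [-> ->].
by move=> [J K] [J' K'] /= [-> ->].
Qed.

(** Binomial theorem: a label in the first part weighs 1, one in the second weighs [N]. *)
Lemma sum_splits (T : Type) (U : seq T) N :
  \sum_(JK <- splits U) N ^ size JK.2 = N.+1 ^ size U.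
Proof.
elim: U => [|x U IHU] /=; first by rewrite big_seq1.
rewrite big_cat !big_map /= IHU expnS mulSn -IHU big_distrr /=.
by congr (_ + _); apply: eq_bigr => JK _; rewrite expnS.
Qed.

(** The same sum with a marked label in the first part; the factor [N.+1] avoids the exponent
    [(size U).-1]. *)
Lemma sum_size_splits (T : Type) (U : seq T) N :
  N.+1 * (\sum_(JK <- splits U) size JK.1 * N ^ size JK.2) = size U * N.+1 ^ size U.
Proof.
elim: U => [|x U IHU] /=; first by rewrite big_seq1 /= muln0.
rewrite big_cat !big_map /=.
under eq_bigr do rewrite mulSn.
rewrite big_split /= sum_splits.
under [X in _ + X]eq_bigr do rewrite expnS mulnCA.
rewrite -big_distrr /= !mulnDr IHU mulnCA IHU expnS; lia.
Qed.

(** * Enumeration of good forests below given roots *)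

Lemma size_cyc_sort_cat p J s : size (cyc_sort p J ++ s) = size J + size s.
Proof. by rewrite size_cat (perm_size (perm_cyc_sort p J)). Qed.

Lemma size_splits (T : eqType) (U : seq T) J K :
  (J, K) \in splits U -> size J + size K = size U.
Proof. by move/splits_perm/perm_size; rewrite size_cat. Qed.

(** Undoes one step of the recursion: the first [size l] forests hang below the children [l] of the
    removed root and are merged into its forest. *)
Definition graft (l : seq nat) (fs : seq forest) : seq forest :=
  assemble l (take (size l) fs) :: drop (size l) fs.

(* [gen m ps U] lists the sequences of good forests, one below each root in
   [ps], with labels [U]; the fuel [m] must be at least [size ps + size U].
   The children of the first root are themselves turned into roots. *)
Fixpoint gen (m : nat) (ps U : seq nat) : seq (seq forest) :=
  match ps, m with
  | [::], _ => if U is [::] then [:: [::]] else [::]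
  | p :: ps', m'.+1 =>
    [seq graft (cyc_sort p JK.1) fs
      | JK <- splits U, fs <- gen m' (cyc_sort p JK.1 ++ ps') JK.2]
  | _, 0 => [::]
  end.

(** Replacing the first root by its children lowers the number of roots and labels by one, whatever
    the children are. All terms of the recurrence thus share one base, and the two sums over splits
    apply. *)
Lemma size_gen m ps U : size ps + size U <= m ->
  (size U + size ps) * size (gen m ps U) = size ps * (size U + size ps) ^ size U.
Proof.
elim: m ps U => [|m IHm] [|p ps] U //=; rewrite ?addn0 ?mul0n.
- by case: U => //= x U; rewrite muln0.
- by case: U => //= x U; rewrite muln0.
rewrite addnS addSn ltnS => lem; set N := size U + size ps.
rewrite size_allpairs_dep sumnE big_map.
(* [N = 0] means a single root and no label; it is treated apart because [N] is cancelled below. *)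
have [N0 | N_gt0] := posnP N.
  move/eqP: N0; rewrite addn_eq0 => /andP[/nilP U0 /nilP ps0]; rewrite /N U0 ps0 /=.
  by rewrite big_seq1 /= /cyc_sort /=; case: (m).
set S := \sum_(_ <- _) _.
have NS : N * S = (size ps) * N.+1 ^ size U + \sum_(JK <- splits U) size JK.1 * N ^ size JK.2.
  rewrite -sum_splits !big_distrr -big_split /= !big_seq; apply: eq_bigr => -[J K] JKU /=.
  have szU : size J + size K = size U := size_splits JKU.
  have := IHm (cyc_sort p J ++ ps) K; rewrite size_cyc_sort_cat.
  have -> : size K + (size J + size ps) = N by rewrite /N; lia.
  move->; first by rewrite mulnDl addnC.
  by rewrite addnAC szU addnC.
apply/eqP; rewrite -(eqn_pmul2l N_gt0); apply/eqP.
rewrite mulnCA NS mulnDr sum_size_splits mulnCA mulnA -mulnDl mulnA; congr (_ * _).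
(* What remains is [size ps * N.+1 + size U = N * (size ps).+1]. *)
rewrite /N; lia.
Qed.

Definition valid ps U fs := all2 good ps fs && perm_eq (flatten (map labels fs)) U.

Lemma all2_cat (S T : Type) (r : S -> T -> bool) s1 s2 t1 t2 : size s1 = size t1 ->
  all2 r (s1 ++ s2) (t1 ++ t2) = all2 r s1 t1 && all2 r s2 t2.
Proof. by elim: s1 t1 => [|x s1 IHs] [|y t1] //= [/IHs->]; rewrite andbA. Qed.

Lemma all2_size (S T : Type) (r : S -> T -> bool) s t : all2 r s t -> size s = size t.
Proof. by rewrite all2E => /andP[/eqP]. Qed.

(** Grafting makes the first forest good by [ascs_cyc_sort]; conversely, the order of the children
    in a good forest is forced by [cyc_sort_unique]. *)
Lemma mem_gen m ps U fs : size ps + size U <= m -> uniq (ps ++ U) ->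
  (fs \in gen m ps U) = valid ps U fs.
Proof.
elim: m ps U fs => [|m IHm] [|p ps] U fs //=.
- by case: U => //= _ _; case: fs => [|f fs].
- case: U => [|x U] /= _ _; case: fs => [|f fs] //=.
  by rewrite in_nil /valid /=; apply/esym/negbTE/negP => /perm_size.
rewrite addSn ltnS => lem /andP[pN Upu].
have /andP[psN UN] : (p \notin ps) && (p \notin U) by rewrite -negb_or -mem_cat.
have uU : uniq U by move: Upu; rewrite cat_uniq => /and3P[].
have IH J K fs' : (J, K) \in splits U ->
    (fs' \in gen m (cyc_sort p J ++ ps) K) = valid (cyc_sort p J ++ ps) K fs'.
  move=> JKU; have permU := splits_perm JKU; apply: IHm.
    have szU : size J + size K = size U := size_splits JKU.
    by rewrite size_cyc_sort_cat addnAC szU addnC.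
  rewrite (perm_uniq (s2 := ps ++ U)) // -catA perm_catCA perm_cat2l.
  by apply: perm_trans permU; rewrite perm_cat2r perm_cyc_sort.
apply/allpairsPdep/andP.
  case=> -[J K] /= [fs' [JKU]]; rewrite IH // => /andP[good' perm'] ->.
  have permU : perm_eq (J ++ K) U := splits_perm JKU.
  have sz' := all2_size good'; rewrite size_cat in sz'.
  rewrite /graft; set l := cyc_sort p J in good' sz' *.
  have permJ : perm_eq l J := perm_cyc_sort p J.
  have szt : size l = size (take (size l) fs').
    by rewrite size_takel // -sz' leq_addr.
  move: good' perm'; rewrite -{1 2}(cat_take_drop (size l) fs').
  rewrite all2_cat // map_cat flatten_cat => /andP[good1 good2] perm'; split=> /=.
    rewrite good2 andbT /good inner_goodE tops_assemble // subs_assemble // good1.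
    rewrite ascs_cyc_sort //=; apply/andP; split.
      by apply: contra UN => pJ; rewrite -(perm_mem permU) mem_cat pJ.
    by move: uU; rewrite -(perm_uniq permU) cat_uniq => /and3P[].
  apply: perm_trans permU; apply: perm_trans (perm_cat permJ perm').
  rewrite catA perm_cat2r; apply: (perm_trans (perm_labels _)).
  by rewrite tops_assemble // subs_assemble.
case: fs => [|f fs] [] //= /andP[/andP[/eqP asc1 goodf] goodfs] perm_f.
rewrite inner_goodE in goodf.
pose J := filter (mem (tops f)) U; pose K := filter (predC (mem (tops f))) U.
have JKU : (J, K) \in splits U := mem_splits _ _.
have perm1 : perm_eq (tops f ++ (flatten (map labels (subs f)) ++ flatten (map labels fs))) U.
  by apply: perm_trans perm_f; rewrite catA perm_cat2r perm_sym perm_labels.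
have uf : uniq (tops f).
  by move: uU; rewrite -(perm_uniq perm1) cat_uniq => /and3P[].
have permJ : perm_eq J (tops f).
  apply: uniq_perm; rewrite ?filter_uniq // => x; rewrite mem_filter inE.
  by apply: andb_idr => xf; rewrite -(perm_mem perm1) mem_cat xf.
have eqJ := cyc_sort_unique permJ asc1.
exists (J, K), (subs f ++ fs); rewrite [(J, K).1]/= [(J, K).2]/= IH // eqJ; split=> //.
  rewrite /valid all2_cat ?size_subs // goodf goodfs map_cat flatten_cat /=.
  rewrite -(perm_cat2l (tops f)); apply: (perm_trans perm1).
  rewrite perm_sym; apply: perm_trans (splits_perm JKU).
  by rewrite perm_cat2r perm_sym.
by rewrite /graft -size_subs take_size_cat // drop_size_cat // assemble_tops_subs.
Qed.

(** The tops of the first forest give back the split, and its subforests with the remaining forests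
    give back the list that was grafted. *)
Lemma gen_uniq m ps U : size ps + size U <= m -> uniq (ps ++ U) -> uniq (gen m ps U).
Proof.
elim: m ps U => [|m IHm] [|p ps] U //=; try by case: U.
rewrite addSn ltnS => lem /andP[_ Upu].
have uU : uniq U by move: Upu; rewrite cat_uniq => /and3P[].
have uJ J K : (J, K) \in splits U -> uniq ((cyc_sort p J ++ ps) ++ K).
  move=> JKU; rewrite (perm_uniq (s2 := ps ++ U)) // -catA perm_catCA perm_cat2l.
  by apply: perm_trans (splits_perm JKU); rewrite perm_cat2r perm_cyc_sort.
have szJ J K : (J, K) \in splits U -> size (cyc_sort p J ++ ps) + size K <= m.
  move=> JKU; have szU : size J + size K = size U := size_splits JKU.
  by rewrite size_cyc_sort_cat addnAC szU addnC.
apply: allpairs_uniq_dep; first exact: splits_uniq.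
  by move=> [J K] JKU; apply: IHm; [apply: szJ | apply: uJ].
move=> u v /allpairsPdep[[J K] [fs [JKU fsg ->]]].
move=> /allpairsPdep[[J' K'] [fs' [JKU' fsg' ->]]] /= eqg.
have tops_graft J0 K0 fs0 : (J0, K0) \in splits U ->
    fs0 \in gen m (cyc_sort p J0 ++ ps) K0 ->
    size (cyc_sort p J0) = size (take (size (cyc_sort p J0)) fs0).
  move=> JKU0; rewrite mem_gen ?szJ ?uJ // => /andP[/all2_size]; rewrite size_cat => sz0 _.
  by rewrite size_takel // -sz0 leq_addr.
have sz1 := tops_graft _ _ _ JKU fsg; have sz2 := tops_graft _ _ _ JKU' fsg'.
case: eqg => eqf eqd.
have eqt : cyc_sort p J = cyc_sort p J'.
  by rewrite -(tops_assemble sz1) eqf tops_assemble.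
have eqJK : (J, K) = (J', K').
  apply: (splits_inj uU) => // x /=.
  by rewrite -(perm_mem (perm_cyc_sort p J)) eqt (perm_mem (perm_cyc_sort p J')).
case: eqJK => eqJ eqK; subst J' K'; congr Tagged.
rewrite -(cat_take_drop (size (cyc_sort p J)) fs) eqd.
by rewrite -(subs_assemble sz1) eqf subs_assemble // cat_take_drop.
Qed.

(** * The final count, with 0 as single root *)

Lemma mem_qs_des n s : 0 < n ->
  (quasi_stirling n s && (des s == n)) =
  (s \in [seq word (head Fnil fs) | fs <- gen n.+1 [:: 0] (iota 1 n)]).
Proof.
move=> n_gt0.
have U0 : uniq ([:: 0] ++ iota 1 n) by rewrite /= iota_uniq mem_iota.
have sz0 : size [:: 0] + size (iota 1 n) <= n.+1 by rewrite size_iota.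
(* By [des_ascs], [n] descents among [2n+1] pairs leave [n+1] non-descents, the value singled out by
   [ascs_good]. *)
have des_good f : perm_eq (labels f) (iota 1 n) -> (des (word f) == n) = good 0 f.
  move=> permf; rewrite -ascs_good.
  have szl : size (labels f) = n by rewrite (perm_size permf) size_iota.
  have szw : size (word f) = n + n by rewrite (perm_size (perm_word f)) size_cat szl.
  have word0 : 0 \notin word f by rewrite mem_word (perm_mem permf) mem_iota.
  have := des_ascs (s := word f); rewrite -size_eq0 -lt0n szw addn_gt0 n_gt0.
  move=> /(_ isT word0); rewrite szl -addnS => eqD.
  by apply/eqP/eqP => eqn; move/eqP: eqD; rewrite eqn ?eqn_add2l ?eqn_add2r => /eqP.
apply/andP/mapP => [[/quasi_stirlingP[f -> permf]] | [fs]].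
  rewrite des_good // => goodf; exists [:: f] => //.
  by rewrite mem_gen // /valid /= goodf cats0.
rewrite mem_gen //; case: fs => [|f [|g fs]] //= /andP[].
  rewrite /= andbT cats0 => goodf permf ->; split; last by rewrite des_good.
  by apply/quasi_stirlingP; exists f.
by rewrite /= andbF.
Qed.

Theorem theorem2p2 (n : nat) : 0 < n -> #|qs_des_n n| = n.+1 ^ n.-1.
Proof.
move=> n_gt0; set L := [seq word (head Fnil fs) | fs <- gen n.+1 [:: 0] (iota 1 n)].
have U0 : uniq ([:: 0] ++ iota 1 n) by rewrite /= iota_uniq mem_iota.
have sz0 : size [:: 0] + size (iota 1 n) <= n.+1 by rewrite size_iota.
have UL : uniq L.
  rewrite map_inj_in_uniq ?gen_uniq // => fs fs'; rewrite !mem_gen //.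
  case: fs => [|f [|? ?]]; case: fs' => [|f' [|? ?]]; rewrite /valid /= ?andbF //.
  rewrite !andbT !cats0 => /andP[_ permf] /andP[_ permf'] eqw.
  by rewrite (@word_inj f f') // (perm_uniq permf, perm_uniq permf') iota_uniq.
have inj : injective (fun t : (n.*2).-tuple 'I_n.+1 => map val t).
  by move=> t t' /(inj_map val_inj)/val_inj.
have permL : perm_eq [seq map val t | t : (n.*2).-tuple 'I_n.+1 <- enum (qs_des_n n)] L.
  apply: uniq_perm => //; first by rewrite map_inj_uniq ?enum_uniq.
  move=> s; rewrite -mem_qs_des //; apply/mapP/idP => [[t] | qs].
    by rewrite mem_enum inE => qs ->.
  have /andP[/andP[perm_s _] _] := qs.
  have {}perm_s := perm_trans perm_s (perm_stirling_multiset n).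
  have size_s : size s == n.*2 by rewrite (perm_size perm_s) size_cat size_iota addnn.
  (* Letters are at most [n], so [inord] keeps their values. *)
  have defs : map val [seq inord x : 'I_n.+1 | x <- s] = s.
    rewrite -map_comp map_id_in // => x; rewrite (perm_mem perm_s) mem_cat orbb.
    by rewrite mem_iota => /= /andP[_ ltx]; rewrite inordK.
  have size_t : size [seq inord x : 'I_n.+1 | x <- s] == n.*2 by rewrite size_map.
  by exists (Tuple size_t); rewrite ?mem_enum ?inE /= ?defs.
rewrite cardE -(size_map (fun t : (n.*2).-tuple 'I_n.+1 => map val t)) (perm_size permL).
rewrite size_map; have := size_gen sz0; rewrite size_iota /= addn1 mul1n.
(* With one root, the size times [n.+1] is [n.+1 ^ n]; as [n] is positive, a factor [n.+1]
   cancels. *)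
case: n n_gt0 {L U0 sz0 UL inj permL} => // n _; rewrite expnS => /eqP.
by rewrite eqn_pmul2l // => /eqP.
Qed.
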